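(* Let $p^0,n^0,\rho^f\in\mathcal{C}$ be real grid functions with $\langle p^0-n^0+\rho^f,1\rangle_h=0$, let $\epsilon>0$, and let $\tau>0$ be arbitrary. Let $(p^k,n^k,\phi^k)_{k\ge 0}$ be the solution of the ETD2 scheme with time step $\tau$. If $p^0\ge 0$ and $n^0\ge 0$ (entrywise), then for every $k\ge0$, $$p^k\ge 0\quad\text{and}\quad n^k\ge 0\quad\text{(entrywise)}.$$
   Context: Let $L>0$, $N\in\mathbb{Z}^+$, $h=L/N$. $\mathcal{C}$ denotes the space of real grid functions $u=(u_{i,j})_{i,j\in\mathbb{Z}}$ that are $N$-periodic in each index (an $N^2$-dimensional space). The discrete inner product is $\langle u,v\rangle_h=h^2\sum_{i,j=1}^N u_{i,j}v_{i,j}$, and $1$ denotes the constant grid function. The discrete Laplacian is $(\Delta_h u)_{i,j}=\frac1{h^2}(u_{i+1,j}+u_{i-1,j}+u_{i,j+1}+u_{i,j-1}-4u_{i,j})$. For $f\in\mathcal{C}$ with $\langle f,1\rangle_h=0$, $(-\epsilon^2\Delta_h)^{-1}f$ denotes the unique $\phi\in\mathcal{C}$ with $-\epsilon^2\Delta_h\phi=f$ and $\langle\phi,1\rangle_h=0$. For $\phi\in\mathcal{C}$, the linear operator $\mathcal{L}_h[\phi]:\mathcal{C}\to\mathcal{C}$ is $$(\mathcal{L}_h[\phi]u)_{i,j}=\frac1{h^2}\sum_{(i',j')}\frac{2e^{\phi_{i',j'}}e^{\phi_{i,j}}}{e^{\phi_{i',j'}}+e^{\phi_{i,j}}}\left(\frac{u_{i',j'}}{e^{\phi_{i',j'}}}-\frac{u_{i,j}}{e^{\phi_{i,j}}}\right),$$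 the sum being over the four neighbours $(i',j')\in\{(i+1,j),(i-1,j),(i,j+1),(i,j-1)\}$. It discretizes $\nabla\cdot(e^{\phi}\nabla(u/e^{\phi}))$. ETD2 scheme (second-order exponential time differencing scheme for the Poisson–Nernst–Planck equations): given $p^0,n^0$, set $\phi^0=(-\epsilon^2\Delta_h)^{-1}(p^0-n^0+\rho^f)$. The first step is $$p^{1}=e^{\tau\mathcal{L}_h[-\phi^0]}p^0,\qquad n^{1}=e^{\tau\mathcal{L}_h[\phi^0]}n^0,\qquad \phi^{1}=(-\epsilon^2\Delta_h)^{-1}(p^{1}-n^{1}+\rho^f),$$ and for $k\ge1$ $$p^{k+1}=e^{2\tau\mathcal{L}_h[-\phi^k]}p^{k-1},\qquad n^{k+1}=e^{2\tau\mathcal{L}_h[\phi^k]}n^{k-1},\qquad \phi^{k+1}=(-\epsilon^2\Delta_h)^{-1}(p^{k+1}-n^{k+1}+\rho^f),$$ where $e^{(\cdot)}$ of an operator is the operator exponential. The scheme is well defined because $p^k-n^k+\rho^f$ has zero mean for every $k$. *)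

(* Defs.v *)
From HB Require Import structures.
From mathcomp Require Import all_boot all_order all_algebra.
From mathcomp Require Import all_classical all_reals all_analysis.

Set Implicit Arguments.
Unset Strict Implicit.
Unset Printing Implicit Defensive.

Import Order.TTheory GRing.Theory Num.Theory.
Import numFieldNormedType.Exports.

Local Open Scope classical_set_scope.
Local Open Scope ring_scope.

Definition biperiodic (R : realType) (N : nat) : {pred int -> int -> R} :=
  [pred u : int -> int -> R | `[< forall i j : int,
     u (i + N%:Z) j = u i j /\ u i (j + N%:Z) = u i j >]].
Arguments biperiodic : clear implicits.

Lemma biperiodicP (R : realType) (N : nat) (u : int -> int -> R) :
  reflect (forall i j : int, u (i + N%:Z) j = u i j /\ u i (j + N%:Z) = u i j)
          (u \in biperiodic R N).
Proof. exact: asboolP. Qed.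

Lemma biperiodic_submod (R : realType) (N : nat) :
  submod_closed (biperiodic R N).
Proof.
split; first by apply/biperiodicP.
move=> a u v /biperiodicP hu /biperiodicP hv; apply/biperiodicP => i j.
have [hu1 hu2] := hu i j; have [hv1 hv2] := hv i j.
have E x y : (a *: u + v) x y = a * u x y + v x y by [].
by rewrite !E hu1 hu2 hv1 hv2.
Qed.

HB.instance Definition _ (R : realType) (N : nat) :=
  GRing.isSubmodClosed.Build R (int -> int -> R) (biperiodic R N)
    (biperiodic_submod R N).

Record grid (R : realType) (N : nat) := Grid {
  grid_fun :> int -> int -> R ;
  grid_per : grid_fun \in biperiodic R N }.
Arguments grid : clear implicits.

HB.instance Definition _ (R : realType) (N : nat) :=
  [isSub for @grid_fun R N].
HB.instance Definition _ (R : realType) (N : nat) :=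
  [Choice of grid R N by <:].
HB.instance Definition _ (R : realType) (N : nat) :=
  [SubChoice_isSubLmodule of grid R N by <:].

Section Discretization.
Context {R : realType} {N : nat}.
Implicit Types (u v f phi : grid R N) (L eps tau : R) (i j : int).

Lemma gridD i j u : u (i + N%:Z) j = u i j /\ u i (j + N%:Z) = u i j.
Proof. by have /biperiodicP := grid_per u. Qed.

Lemma cst_grid_per (c : R) : (fun _ _ : int => c) \in biperiodic R N.
Proof. exact/biperiodicP. Qed.
Definition cst_grid (c : R) : grid R N := Grid (cst_grid_per c).

Definition mesh L : R := L / N%:R.

Definition inner L u v : R :=
  mesh L ^+ 2 *
  \sum_(1 <= i < N.+1) \sum_(1 <= j < N.+1) u i%:Z j%:Z * v i%:Z j%:Z.

Definition lap_fun L u i j : R :=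
  (mesh L ^+ 2)^-1 *
  (u (i + 1) j + u (i - 1) j + u i (j + 1) + u i (j - 1) - 4 * u i j).

Lemma lap_per L u : lap_fun L u \in biperiodic R N.
Proof.
apply/biperiodicP => i j; rewrite /lap_fun ![_ + N%:Z + _]addrAC.
by rewrite !(fun a b => (gridD a b u).1) !(fun a b => (gridD a b u).2).
Qed.
Definition lap L u : grid R N := Grid (lap_per L u).

(* The zero-mean solution of [- eps^2 lap phi = f].  For positive [L], [eps]
   and [N] it exists and is unique as soon as [f] has zero mean; the default
   value 0 only matters for those [f] without a solution. *)
Definition poisson_inv L eps f : grid R N :=
  xget 0 [set phi | - (eps ^+ 2 *: lap L phi) = f /\
                    inner L phi (cst_grid 1) = 0].

Definition neighbours i j : seq (int * int) :=
  [:: (i + 1, j); (i - 1, j); (i, j + 1); (i, j - 1)].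

Definition drift_diff_fun L phi u i j : R :=
  (mesh L ^+ 2)^-1 * \sum_(q <- neighbours i j)
    2 * expR (phi q.1 q.2) * expR (phi i j)
      / (expR (phi q.1 q.2) + expR (phi i j))
    * (u q.1 q.2 / expR (phi q.1 q.2) - u i j / expR (phi i j)).

Lemma drift_diff_per L phi u : drift_diff_fun L phi u \in biperiodic R N.
Proof.
apply/biperiodicP => i j; rewrite /drift_diff_fun /neighbours !big_cons !big_nil /=.
rewrite ![_ + N%:Z + _]addrAC.
by rewrite !(fun v a b => (gridD a b v).1) !(fun v a b => (gridD a b v).2).
Qed.

(* [drift_diff L phi] discretizes [u |-> div (e^phi grad (u / e^phi))]. *)
Definition drift_diff L phi : grid R N -> grid R N :=
  fun u => Grid (drift_diff_per L phi u).

(* Operator exponential, [e^A u = \sum_k A^k u / k!].  The space of grid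
   functions is finite-dimensional, so for linear [A] the convergence of the
   exponential series in operator norm is the same as the entrywise
   convergence of the series applied to every [u]. *)
Definition expop_fun (A : grid R N -> grid R N) u i j : R :=
  limn (series (fun k => (k`!%:R)^-1 * iter k A u i j)).

Lemma expop_per A u : expop_fun A u \in biperiodic R N.
Proof.
apply/biperiodicP => i j; rewrite /expop_fun.
have e k := gridD i j (iter k A u).
by split; congr (limn (series _)); apply/funext => k; rewrite ?(e k).1 ?(e k).2.
Qed.
Definition expop (A : grid R N -> grid R N) : grid R N -> grid R N :=
  fun u => Grid (expop_per A u).

Record ETD2_solution L eps tau (rhof p0 n0 : grid R N)
    (p n phi : nat -> grid R N) : Prop := {
  ETD2_p0 : p 0%N = p0 ;
  ETD2_n0 : n 0%N = n0 ;
  ETD2_p1 : p 1%N = expop (tau *: drift_diff L (- phi 0%N)) (p 0%N) ;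
  ETD2_n1 : n 1%N = expop (tau *: drift_diff L (phi 0%N)) (n 0%N) ;
  ETD2_p : forall k, (1 <= k)%N ->
    p k.+1 = expop ((2 * tau) *: drift_diff L (- phi k)) (p k.-1) ;
  ETD2_n : forall k, (1 <= k)%N ->
    n k.+1 = expop ((2 * tau) *: drift_diff L (phi k)) (n k.-1) ;
  ETD2_phi : forall k, phi k = poisson_inv L eps (p k - n k + rhof) }.

Definition grid_nonneg u : Prop := forall i j, 0 <= u i j.

End Discretization.

(* Main.v *)
(* The off-diagonal entries of [A = t * drift_diff L phi] are nonnegative and its
   diagonal is bounded below by some [- c], so [B = A + c] preserves
   nonnegativity.  Expanding [A ^ k = (B - c) ^ k], the [n]-th partial sum of
   [e^A u] is [\sum_(j < n) B^j u / j! * S_(n - j)], where [S_m] is the [m]-th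
   partial sum of [e^(- c)].  As [S_m >= - e^c * c^m / m!] and
   [0 <= B^j u <= M * beta^j], this is at least
   [- M * e^c * (c + beta)^n / n!], which tends to 0. *)

From HB Require Import structures.
Require Import Defs.
From mathcomp Require Import all_boot all_order all_algebra.
From mathcomp Require Import all_classical all_reals all_analysis.
From mathcomp Require Import ring lra.

Import Order.TTheory GRing.Theory Num.Theory.
Import numFieldNormedType.Exports.

Local Open Scope ring_scope.

(** Binomial theorem: the homothety by [a] commutes with the linear [f], and Pascal's rule closes
    the induction. *)
Lemma iter_add_scale (K : comPzRingType) (V : lmodType K)
    (f : {linear V -> V}) (a : K) (u : V) k :
  iter k (fun v => f v + a *: v) u =
    \sum_(i < k.+1) (a ^+ (k - i) *+ 'C(k, i)) *: iter i f u.
Proof.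
elim: k => [|k IHk]; first by rewrite big_ord1 expr0 bin0 scale1r.
rewrite iterS IHk linear_sum [RHS]big_ord_recl /= subn0 bin0.
under [X in _ = _ + X]eq_bigr => i _.
  rewrite /bump /= add1n binS mulrnDr scalerDl subSS; over.
rewrite big_split /= addrA [LHS]addrC; congr (_ + _).
  rewrite big_ord_recl [in RHS]big_ord_recr /= (bin_small (ltnSn k)) mulr0n scale0r addr0.
  rewrite scalerDr scalerA subn0 bin0 -exprS; congr (_ + _).
  rewrite scaler_sumr; apply: eq_bigr => i _.
  by rewrite scalerA mulrnAr -exprS /bump /= add1n subnSK.
by apply: eq_bigr => i _; rewrite linearZ.
Qed.

Section ExpCoeff.
Context {R : realType}.
Implicit Types (x y c : R) (k m : nat).

(** Turns the binomial expansion of a power, divided by the factorial of [k], into a Cauchy product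
    of exponential series. *)
Lemma exp_coeff_bin x k i : (i <= k)%N ->
  (x ^+ (k - i) *+ 'C(k, i)) / k`!%:R = exp_coeff x (k - i)%N / i`!%:R.
Proof.
move=> ik; have nz m : (0 < m)%N -> m%:R != 0 :> R by rewrite pnatr_eq0 lt0n.
rewrite /exp_coeff /= -(bin_fact ik) -[_ *+ 'C(k, i)]mulr_natr !natrM.
by field; rewrite !nz ?fact_gt0 ?bin_gt0.
Qed.

Lemma exp_coeffD x y k :
  exp_coeff (x + y) k = \sum_(i < k.+1) exp_coeff x (k - i)%N * exp_coeff y i.
Proof.
rewrite {1}/exp_coeff /= exprDn mulr_suml; apply: eq_bigr => i _.
rewrite -mulrnAl mulrAC exp_coeff_bin -1?ltnS //.
by rewrite mulrAC mulrA.
Qed.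

(** A binomial coefficient is at least 1, hence [m! k! <= (m + k)!]. *)
Lemma exp_coeff_addn_le c m k : 0 <= c ->
  exp_coeff c (m + k)%N <= exp_coeff c m * exp_coeff c k.
Proof.
move=> c0; rewrite /exp_coeff /= mulf_div -exprD.
apply: ler_wpM2l; first exact: exprn_ge0.
rewrite lef_pV2 ?posrE ?mulr_gt0 ?ltr0n ?fact_gt0 // -natrM ler_nat.
have mk : (m <= m + k)%N := leq_addr k m.
by rewrite -(bin_fact mk) addKn leq_pmull // bin_gt0.
Qed.

(** The tail of the series of [e^(- c)] from index [m] on is at most the sum of [c^k / k!] over
    [k >= m], hence at most [e^c * c^m / m!]; and [e^(- c)] itself is nonnegative. *)
Lemma exp_series_ge c m : 0 <= c ->
  - (expR c * exp_coeff c m) <= series (exp_coeff (- c)) m.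
Proof.
move=> c0; rewrite lerNl.
suff: expR (- c) - series (exp_coeff (- c)) m <= expR c * exp_coeff c m.
  by apply: le_trans; rewrite lerDr expR_ge0.
rewrite lerBlDr; apply: limr_le; first exact: is_cvg_series_exp_coeff.
near=> n.
have mn : (m <= n)%N by near: n; exact: nbhs_infty_ge.
rewrite -lerBlDr sub_series_geq // mulrC.
have S : forall k, series (exp_coeff c) k <= expR c.
  move=> k; apply: nondecreasing_cvgn_le; last exact: is_cvg_series_exp_coeff.
  by apply/nondecreasing_series => i _ _; exact: exp_coeff_ge0.
apply: (@le_trans _ _ (exp_coeff c m * series (exp_coeff c) (n - m)%N)); last first.
  by apply: ler_wpM2l => //; exact: exp_coeff_ge0.
rewrite /series /= -{1}[m]add0n big_addn mulr_sumr; apply: ler_sum => k _.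
rewrite addnC; apply: (le_trans _ (exp_coeff_addn_le c m k c0)).
rewrite /exp_coeff /= ler_pM2r ?invr_gt0 ?ltr0n ?fact_gt0 //.
by rewrite (le_trans (ler_norm _)) // normrX normrN ger0_norm.
Unshelve. all: by end_near. Qed.

End ExpCoeff.

(** Both sides run over the pairs [(i, j)] with [i + j < n], once by antidiagonals and once by
    columns. *)
Lemma sum_triangle (V : nmodType) (F : nat -> nat -> V) n :
  \sum_(k < n) \sum_(j < k.+1) F (k - j)%N j =
  \sum_(j < n) \sum_(i < (n - j)%N) F i j.
Proof.
elim: n => [|n IHn]; first by rewrite !big_ord0.
rewrite big_ord_recr /= IHn [RHS]big_ord_recr /= subSnn big_ord1.
under [X in _ = X + _]eq_bigr => j _.
  rewrite subSn ?(ltnW (ltn_ord j)) // big_ord_recr /=; over.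
by rewrite big_split /= -addrA [in LHS]big_ord_recr /= subnn.
Qed.

Lemma series_exp_conv_ge0 (R : realType) (c beta M : R) (b : nat -> R) :
  0 <= c -> 0 <= beta ->
  (forall j, 0 <= b j <= M * exp_coeff beta j) ->
  0 <= limn (series (fun k => \sum_(j < k.+1) exp_coeff (- c) (k - j)%N * b j)).
Proof.
move=> c0 beta0 hb.
have M0 : 0 <= M.
  have /andP[h1 h2] := hb 0%N; have := le_trans h1 h2.
  by rewrite /exp_coeff /= expr0 fact0 divr1 mulr1.
have b0 j : 0 <= b j by case/andP: (hb j).
have hsum k : \sum_(j < k.+1) exp_coeff c (k - j)%N * b j
    <= M * exp_coeff (c + beta) k.
  rewrite exp_coeffD mulr_sumr; apply: ler_sum => j _.
  rewrite mulrCA; apply: ler_wpM2l; first exact: exp_coeff_ge0.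
  by case/andP: (hb j).
pose e k := \sum_(j < k.+1) exp_coeff (- c) (k - j)%N * b j.
(* [limn] is informative only for a convergent sequence; [hsum] gives absolute convergence by
   comparison with the series of [M * e^(c + beta)]. *)
have cvg_e : cvgn (series e).
  apply: normed_cvg.
  apply: (@series_le_cvg _ _ (fun k => M * exp_coeff (c + beta) k)) => //.
  - by move=> n /=; exact: normr_ge0.
  - by move=> n; rewrite mulr_ge0 // exp_coeff_ge0 // addr_ge0.
  - move=> n; apply: le_trans (hsum n); apply: le_trans (ler_norm_sum _ _ _) _.
    apply: ler_sum => j _; rewrite normrM [`|b j|]ger0_norm //.
    apply: ler_wpM2r => //.
    by rewrite /exp_coeff /= normrM normrX normrN (ger0_norm c0) normfV normr_nat.
  - exact: is_cvg_seriesZ (is_cvg_series_exp_coeff _).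
have series_e n :
    series e n = \sum_(0 <= j < n) series (exp_coeff (- c)) (n - j)%N * b j.
  rewrite /series /= /e !big_mkord.
  rewrite (sum_triangle _ (fun l j => exp_coeff (- c) l * b j)).
  by apply: eq_bigr => j _; rewrite big_mkord mulr_suml.
pose K := expR c * M.
have lower n : - (K * exp_coeff (c + beta) n) <= series e n.
  rewrite series_e lerNl -sumrN big_mkord.
  rewrite /K -mulrA; apply: le_trans (ler_wpM2l (expR_ge0 c) (hsum n)).
  (* The sum in [hsum n] has the extra term [j = n], which is nonnegative and is dropped; the others
     compare one by one through [exp_series_ge]. *)
  rewrite big_ord_recr /= mulrDr; apply: ler_wpDr.
    by apply: mulr_ge0 (expR_ge0 _) (mulr_ge0 (exp_coeff_ge0 _ c0) (b0 _)).
  rewrite mulr_sumr; apply: ler_sum => j _.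
  rewrite -mulNr mulrA; apply: ler_wpM2r => //.
  by rewrite lerNl exp_series_ge.
apply: (ler_cvg_to _ cvg_e (nearW _ lower)).
rewrite -oppr0 -(mulr0 K); apply: cvgN; apply: cvgM; first exact: cvg_cst.
exact: cvg_exp_coeff.
Qed.

Section Grid.
Context {R : realType} {N : nat}.
Implicit Types (u v phi : grid R N) (c L : R).

(** Periodicity moves every point into one [N] by [N] cell, and the sum of the absolute values over
    that cell serves as the bound. *)
Lemma grid_bounded u : (0 < N)%N ->
  exists2 M : R, 0 <= M & forall i j, `|u i j| <= M.
Proof.
move=> N0.
have peri k : (forall i j, u (i + (k * N)%N%:Z) j = u i j) /\
    (forall i j, u i (j + (k * N)%N%:Z) = u i j).
  elim: k => [|k [IH1 IH2]]; first by split=> i j; rewrite mul0n addr0.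
  by split=> i j; rewrite mulSn PoszD addrA ?IH1 ?IH2;
    have [] := gridD i j u.
have perz (d : int) : (forall i j, u (i + d * N%:Z) j = u i j) /\
    (forall i j, u i (j + d * N%:Z) = u i j).
  case: d => k; first exact: peri.
  split=> i j; rewrite NegzE mulNr.
    by rewrite -[LHS](peri k.+1).1 subrK.
  by rewrite -[LHS](peri k.+1).2 subrK.
have red (i : int) : exists a : 'I_N, exists d : int, i = a%:Z + d * N%:Z.
  have Nz : (N%:Z != 0)%R by rewrite eqz_nat -lt0n.
  have lt : (`|(i %% N%:Z)%Z|%N < N)%N.
    by rewrite -ltz_nat gez0_abs ?modz_ge0 // ltz_mod.
  exists (Ordinal lt), (i %/ N%:Z)%Z.
  by rewrite /= gez0_abs ?modz_ge0 // addrC -divz_eq.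
exists (\sum_(a < N) \sum_(b < N) `|u a%:Z b%:Z|).
  by apply: sumr_ge0 => a _; apply: sumr_ge0.
move=> i j; have [a [d ->]] := red i; have [b [d' ->]] := red j.
rewrite (perz d).1 (perz d').2 (bigD1 a) //= (bigD1 b) //= -addrA lerDl.
by rewrite addr_ge0 // sumr_ge0 // => k _; rewrite sumr_ge0.
Qed.

Lemma grid_sumE n (F : 'I_n -> grid R N) i j :
  (\sum_(k < n) F k) i j = \sum_(k < n) F k i j.
Proof. by elim/big_rec2: _ => // k _ v _ <-. Qed.

Lemma expop_nonneg (A : {linear grid R N -> grid R N}) (c : R) u :
  (0 < N)%N -> 0 <= c ->
  (forall v, grid_nonneg v -> grid_nonneg (A v + c *: v)) ->
  grid_nonneg u -> grid_nonneg (expop A u).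
Proof.
move=> N0 c0 pos u0 i j.
have [B BE] : exists B : {linear grid R N -> grid R N},
    forall v, B v = A v + c *: v by exists (A \+ c \*: idfun).
have iterB_ge0 k : grid_nonneg (iter k B u) by elim: k => //= k IHk; rewrite BE; exact: pos.
(* A positive operator is controlled by its value on the constant 1, so this [beta] is the growth
   rate of the powers of [B]. *)
have [beta beta0 hbeta] := grid_bounded (B (cst_grid 1)) N0.
have [M M0 hM] := grid_bounded u N0.
have iterB_le k x y : iter k B u x y <= M * beta ^+ k.
  elim: k x y => [|k IHk] x y /=.
    by rewrite expr0 mulr1 (le_trans (ler_norm _)).
  (* By the induction hypothesis this difference is nonnegative, so its image under [B] is too. *)
  have /pos/(_ x y) : grid_nonneg ((M * beta ^+ k) *: cst_grid 1 - iter k B u).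
    move=> x' y'.
    suff -> : ((M * beta ^+ k) *: cst_grid 1 - iter k B u) x' y' =
      M * beta ^+ k * 1 - iter k B u x' y' by rewrite mulr1 subr_ge0.
    by [].
  rewrite -BE linearB linearZ => h.
  have {h} : 0 <= M * beta ^+ k * B (cst_grid 1) x y - B (iter k B u) x y := h.
  rewrite subr_ge0 => h; apply: (le_trans h).
  rewrite exprSr mulrA; apply: ler_wpM2l; first by rewrite mulr_ge0 ?exprn_ge0.
  exact: le_trans (ler_norm _) (hbeta _ _).
have AE : (A : _ -> _) = fun v => B v + (- c) *: v.
  by apply/funext => v; rewrite BE scaleNr addrK.
rewrite /expop /= /expop_fun.
pose b l : R := (l`!%:R)^-1 * iter l B u i j.
rewrite (_ : (fun k => _) = fun k =>
    \sum_(l < k.+1) exp_coeff (- c) (k - l)%N * b l).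
  apply: (series_exp_conv_ge0 R c beta M b) => // l; apply/andP; split.
    by rewrite mulr_ge0 ?invr_ge0 //; exact: iterB_ge0.
  rewrite /b /exp_coeff /= mulrA [leLHS]mulrC.
  by apply: ler_wpM2r; rewrite ?invr_ge0.
(* Expanding [(B - c)^k / k!] yields exactly the convolution treated by [series_exp_conv_ge0]. *)
apply/funext => k; rewrite AE iter_add_scale grid_sumE mulr_sumr.
apply: eq_bigr => l _.
have -> : (((- c) ^+ (k - l) *+ 'C(k, l)) *: iter l B u) i j =
  ((- c) ^+ (k - l) *+ 'C(k, l)) * iter l B u i j by [].
by rewrite mulrA [_^-1 * _]mulrC exp_coeff_bin -1?ltnS // /b mulrA.
Qed.

Lemma drift_diff_linear L phi : linear (@drift_diff R N L phi).
Proof.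
move=> a u v; apply: val_inj; apply/funext => i; apply/funext => j.
have E x y : (a *: u + v) x y = a * u x y + v x y by [].
suff -> : \val (a *: drift_diff L phi u + drift_diff L phi v) i j =
  a * drift_diff_fun L phi u i j + drift_diff_fun L phi v i j.
  rewrite -[LHS]/(drift_diff_fun L phi (a *: u + v) i j) /drift_diff_fun.
  rewrite /neighbours !big_cons !big_nil !E; ring.
by [].
Qed.

HB.instance Definition _ L phi :=
  GRing.isLinear.Build R (grid R N) (grid R N) *:%R (@drift_diff R N L phi)
    (drift_diff_linear L phi).

(* The flux through one edge contributes at most [2 / h^2] to the diagonal of
   [drift_diff], since [e^x / (e^x + e^y) <= 1]; there are four edges. *)
Lemma drift_diff_shift_nonneg L phi v :
  grid_nonneg v -> grid_nonneg (drift_diff L phi v + (8 / @mesh R N L ^+ 2) *: v).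
Proof.
move=> v0 i j.
suff -> : (drift_diff L phi v + (8 / @mesh R N L ^+ 2) *: v) i j =
  drift_diff_fun L phi v i j + (8 / @mesh R N L ^+ 2) * v i j.
  have edge x y : - (2 * v i j) <=
      2 * expR (phi x y) * expR (phi i j) / (expR (phi x y) + expR (phi i j))
      * (v x y / expR (phi x y) - v i j / expR (phi i j)).
    have := expR_gt0 (phi x y); have := expR_gt0 (phi i j).
    move: (expR (phi x y)) (expR (phi i j)) (v0 x y) (v0 i j) => f g.
    move: (v x y) (v i j) => a b a0 b0 g0 f0; have fg : 0 < f + g by lra.
    have -> : 2 * f * g / (f + g) * (a / f - b / g) = 2 * (a * g - b * f) / (f + g).
      by field; rewrite !gt_eqF.
    (* Once [f + g] is cleared, the claim amounts to [0 <= 2 * g * (a + b)]. *)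
    rewrite ler_pdivlMr //; nra.
  rewrite /drift_diff_fun /neighbours !big_cons big_nil /=.
  have := edge (i + 1) j; have := edge (i - 1) j.
  have := edge i (j + 1); have := edge i (j - 1).
  set e1 := _ * (_ - _); set e2 := _ * (_ - _); set e3 := _ * (_ - _).
  set e4 := _ * (_ - _) => h1 h2 h3 h4.
  rewrite [8 / _]mulrC -mulrA -mulrDr mulr_ge0 ?invr_ge0 ?sqr_ge0 //; lra.
by [].
Qed.

(** The shift [8 / h^2] is simply scaled by [t], so positivity holds without any upper bound on the
    time step. *)
Lemma expop_drift_diff_nonneg L phi (t : R) u : (0 < N)%N -> 0 <= t ->
  grid_nonneg u -> grid_nonneg (expop (t *: drift_diff L phi) u).
Proof.
move=> N0 t0; pose A : {linear grid R N -> grid R N} := t \*: drift_diff L phi.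
rewrite -[t *: drift_diff L phi]/(A : _ -> _).
apply: (expop_nonneg A (t * (8 / @mesh R N L ^+ 2))) => // [|v v0].
  by rewrite mulr_ge0 // divr_ge0 // sqr_ge0.
rewrite -scalerA -scalerDr => i j.
suff -> : (t *: (drift_diff L phi v + (8 / @mesh R N L ^+ 2) *: v)) i j =
  t * (drift_diff L phi v + (8 / @mesh R N L ^+ 2) *: v) i j.
  by rewrite mulr_ge0 //; exact: drift_diff_shift_nonneg.
by [].
Qed.

End Grid.

Theorem theorem4 (R : realType) (N : nat) (L eps tau : R)
    (p0 n0 rhof : grid R N) (p n phi : nat -> grid R N) :
  (0 < N)%N -> 0 < L -> 0 < eps -> 0 < tau ->
  inner L (p0 - n0 + rhof) (cst_grid 1) = 0 ->
  ETD2_solution L eps tau rhof p0 n0 p n phi ->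
  grid_nonneg p0 -> grid_nonneg n0 ->
  forall k : nat, grid_nonneg (p k) /\ grid_nonneg (n k).
Proof.
move=> N0 _ _ /ltW tau0 _ [p_0 n_0 p_1 n_1 p_S n_S _] p0_ge0 n0_ge0 k.
have tau2 : 0 <= 2 * tau by rewrite mulr_ge0.
(* The recursion reaches back two levels, so the induction carries two consecutive levels; the
   separate first step supplies level 1. *)
suff [] : (grid_nonneg (p k) /\ grid_nonneg (n k)) /\
  (grid_nonneg (p k.+1) /\ grid_nonneg (n k.+1)) by [].
elim: k => [|k [[pk nk] IHk]].
  rewrite p_1 n_1 p_0 n_0; do !split => //; exact: expop_drift_diff_nonneg.
split=> //; rewrite p_S // n_S //.
by split; exact: expop_drift_diff_nonneg.
Qed.
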